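(* Let $\xi:\mathbb Z^k\to\mathbb R$ be a monomorphism and $\Gamma=(\xi_1,\dots,\xi_k)$ a $\xi$-regular family of homomorphisms $\mathbb Z^k\to\mathbb Z$. Let $t_1,\dots,t_k$ be the basis of $\mathbb Z^k$ dual to the basis $(-\xi_1,\dots,-\xi_k)$ of $\mathrm{Hom}(\mathbb Z^k,\mathbb Z)$. Put $\Lambda=\mathbb Z[\mathbb Z^k]$. Then the ring $\widehat\Lambda_\Gamma^-$ is isomorphic to the ring of special power series in the variables $t_1,\dots,t_k$ with coefficients in $\mathbb Z$, and the ring $\widehat\Lambda_\Gamma$ is isomorphic to the ring of special Laurent series in the variables $t_1,\dots,t_k$ with coefficients in $\mathbb Z$.
   Context: $\xi$-regular: $(\xi_1,\dots,\xi_k)$ is a basis of the free abelian group $\mathrm{Hom}(\mathbb Z^k,\mathbb Z)$ and all coordinates of $\xi$ in this basis are strictly positive. With $G=\mathbb Z^k$: let $\widehat{\widehat\Lambda}$ be the set of all (possibly infinite) formal combinations $\lambda=\sum_{g\in G}n_gg$, $n_g\in\mathbb Z$, $\mathrm{supp}\,\lambda=\{g:n_g\neq0\}$. For a homomorphism $\eta:G\to\mathbb R$, $\widehat\Lambda_\eta$ is the ring of all $\lambda$ such that $\{g\in\mathrm{supp}\,\lambda:\eta(g)\geq C\}$ is finite for every $C\in\mathbb R$, and $\widehat\Lambda_\eta^-=\{\lambda\in\widehat\Lambda_\eta:\mathrm{supp}\,\lambda\subset\eta^{-1}(]-\infty,0])\}$. Put $\widehat\Lambda_\Gamma=\bigcap_i\widehat\Lambda_{\xi_i}$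 and $\widehat\Lambda_\Gamma^-=\bigcap_i\widehat\Lambda_{\xi_i}^-$. A sequence of multi-indices $I_n=(i_1^{(n)},\dots,i_k^{(n)})\in\mathbb Z^k$ strongly converges to $\infty$ if $i_j^{(n)}\to\infty$ as $n\to\infty$ for every $j$. A special power series (resp. special Laurent series) with coefficients in a commutative ring $R$ is a series $\sum_{n=0}^\infty a_nt^{I_n}$ with $a_n\in R$, $I_n\in\mathbb N^k$ (resp. $I_n\in\mathbb Z^k$), where $I_n$ strongly converges to $\infty$; here $t^I=t_1^{i_1}\cdots t_k^{i_k}$. These form rings under the usual operations. *)

(* Defs.v *)
From HB Require Import structures.
From mathcomp Require Import all_boot all_order all_algebra.
From mathcomp Require Import boolp classical_sets functions cardinality fsbigop.
From mathcomp Require Import filter reals.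

Set Implicit Arguments.
Unset Strict Implicit.
Unset Printing Implicit Defensive.

Import Order.TTheory GRing.Theory Num.Theory.
Local Open Scope classical_set_scope.
Local Open Scope ring_scope.

(* A formal combination \sum_(g in G) n_g g is the function g |-> n_g. *)
Section Formal.
Variables (G : zmodType) (A : comPzRingType).
Implicit Types f g : G -> A.

Definition supp f : set G := [set x | f x != 0].

Definition mono (x : G) : G -> A := fun y => (y == x)%:R.

(* \sum_(y \in setT) has value 0 when infinitely many terms are nonzero; this
   does not happen on the sets of formal combinations considered below. *)
Definition conv f g : G -> A := fun x => \sum_(y \in [set: G]) f y * g (x - y).

Lemma conv_seq (s : seq G) f g x : uniq s ->
    (forall y, f y != 0 -> g (x - y) != 0 -> y \in s) ->
  conv f g x = \sum_(y <- s) f y * g (x - y).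
Proof.
move=> us sP; rewrite /conv (@fsbigE _ _ _ _ _ s) //.
  by apply: eq_bigl => y; rewrite in_setT.
move=> y _ ys; have [->|fy] := eqVneq (f y) 0; first by rewrite mul0r.
have [->|gy] := eqVneq (g (x - y)) 0; first by rewrite mulr0.
by rewrite (sP y fy gy) in ys.
Qed.

Lemma convC f g : conv f g = conv g f.
Proof.
apply/funext => x; rewrite /conv (@reindex_fsbigT _ _ _ _ _ (fun y => x - y)).
  by apply: eq_fsbigr => y _; rewrite mulrC subKr.
by exists (fun y => x - y) => y; rewrite subKr.
Qed.

Lemma conv_neq0 f g x : conv f g x != 0 ->
  exists y, f y != 0 /\ g (x - y) != 0.
Proof.
move=> fgx; apply: contrapT => nex; move/negP: fgx; apply; apply/eqP.
rewrite /conv fsbig1// => y _; apply: contrapT => /eqP fgy; apply: nex.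
exists y; split; apply/negP => /eqP E; move: fgy.
  by rewrite E mul0r eqxx.
by rewrite E mulr0 eqxx.
Qed.

Lemma mono_conv f : conv (mono 0) f = f.
Proof.
apply/funext => x; rewrite (@conv_seq [:: 0]) //.
  by rewrite big_seq1 /mono eqxx mul1r subr0.
by move=> y; rewrite /mono inE; case: (y == 0) => //; rewrite eqxx.
Qed.

Lemma finite_uniq_seq (T : choiceType) (B : set T) :
  finite_set B -> exists2 s : seq T, uniq s & forall y, B y -> y \in s.
Proof.
move=> /finite_seqP[s ->]; exists (undup s); first exact: undup_uniq.
by move=> y; rewrite mem_undup.
Qed.

(* A set of formal combinations which is a ring under convolution, because
   membership only depends on the support and the admissible supports form a
   family stable under subsets, unions and sums, with finitely many
   decompositions of every element as a sum. *)
Record convSet := ConvSet {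
  carrier : set (G -> A);
  fam : set (set G);
  carrierE : forall f, carrier f <-> fam (supp f);
  fam1 : fam [set 0];
  famS : forall B C, B `<=` C -> fam C -> fam B;
  famU : forall B C, fam B -> fam C -> fam (B `|` C);
  famD : forall B C, fam B -> fam C -> fam [set x | exists y, B y /\ C (x - y)];
  famF : forall B C x, fam B -> fam C -> finite_set [set y | B y /\ C (x - y)]
}.

Definition in_carrier (S : convSet) : {pred G -> A} :=
  fun f => f \in carrier S.

Record series (S : convSet) :=
  Series { coef :> G -> A; coefP : coef \in in_carrier S }.

HB.instance Definition _ (S : convSet) := [isSub for @coef S].
HB.instance Definition _ (S : convSet) := [Choice of series S by <:].

Section Ring.
Variable S : convSet.

Lemma conv_fin f g x : carrier S f -> carrier S g ->
  exists2 s : seq G, uniq s & forall y, f y != 0 -> g (x - y) != 0 -> y \in s.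
Proof.
move=> /carrierE Sf /carrierE Sg.
have [s us sP] := finite_uniq_seq (famF x Sf Sg).
by exists s => // y fy gy; apply: sP.
Qed.

Lemma conv_closed f g : carrier S f -> carrier S g -> carrier S (conv f g).
Proof.
move=> /carrierE Sf /carrierE Sg; apply/carrierE.
by apply: famS (famD Sf Sg) => x /conv_neq0[y [fy gy]]; exists y.
Qed.

Lemma convA f g h : carrier S f -> carrier S g -> carrier S h ->
  conv f (conv g h) = conv (conv f g) h.
Proof.
move=> Sf Sg Sh; apply/funext => x.
have [U uU UP] : exists2 U : seq G, uniq U & forall u y,
    f y != 0 -> g (u - y) != 0 -> h (x - u) != 0 -> u \in U.
  move: Sf Sg Sh => /carrierE Sf /carrierE Sg /carrierE Sh.
  have [U uU UP] := finite_uniq_seq (famF x (famD Sf Sg) Sh).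
  by exists U => // u y fy gy hy; apply: UP; split => //; exists y.
have [Y uY YP] : exists2 Y : seq G, uniq Y & forall u y,
    u \in U -> f y != 0 -> g (u - y) != 0 -> y \in Y.
  move: Sf Sg => /carrierE Sf /carrierE Sg.
  have [Y uY YP] := finite_uniq_seq (bigcup_finite
    (finite_seq U) (fun u _ => famF u Sf Sg)).
  by exists Y => // u y Uu fy gy; apply: YP; exists u.
rewrite [RHS](@conv_seq U) //; last first.
  by move=> u /conv_neq0[y [fy gy]]; exact: UP fy gy.
rewrite [LHS](@conv_seq Y) //; last first.
  move=> y fy /conv_neq0[z [gz hz]].
  have gz' : g (z + y - y) != 0 by rewrite addrK.
  have hz' : h (x - (z + y)) != 0 by rewrite opprD addrA addrAC.
  exact: YP (UP _ _ fy gz' hz') fy gz'.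
transitivity (\sum_(y <- Y) \sum_(u <- U) f y * g (u - y) * h (x - u)).
  apply: eq_bigr => y _; have [->|fy] := eqVneq (f y) 0.
    by rewrite mul0r big1// => u _; rewrite !mul0r.
  rewrite (@conv_seq [seq u - y | u <- U]).
  - rewrite big_map mulr_sumr; apply: eq_bigr => u _.
    by rewrite mulrA opprB addrA subrK.
  - by rewrite map_inj_uniq// => a b /addIr.
  - move=> z gz hz; apply/mapP; exists (z + y); last by rewrite addrK.
    apply: (UP _ y) => //; first by rewrite addrK.
    by rewrite opprD addrA addrAC.
rewrite exchange_big /=; apply: eq_big_seq => u Uu.
rewrite (@conv_seq Y) ?mulr_suml// => y fy gy; exact: YP Uu fy gy.
Qed.

Lemma convDl f g h : carrier S f -> carrier S g -> carrier S h ->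
  conv (f + g) h = conv f h + conv g h.
Proof.
move=> Sf Sg Sh; apply/funext => x.
have [s us sP] := conv_fin x Sf Sh; have [r ur rP] := conv_fin x Sg Sh.
have inl y : f y != 0 -> h (x - y) != 0 -> y \in undup (s ++ r).
  by move=> fy hy; rewrite mem_undup mem_cat sP.
have inr y : g y != 0 -> h (x - y) != 0 -> y \in undup (s ++ r).
  by move=> fy hy; rewrite mem_undup mem_cat rP// orbT.
rewrite [RHS]/GRing.add /= !(@conv_seq (undup (s ++ r))) ?undup_uniq//.
  by rewrite -big_split /=; apply: eq_bigr => y _; rewrite mulrDl.
move=> y fgy hy; have [fy|/inl] := eqVneq (f y) 0; last exact.
apply: inr => //; apply: contra_neq fgy => gy.
by rewrite /GRing.add /= fy gy addr0.
Qed.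

Lemma carrier_zmod_closed : zmod_closed (in_carrier S).
Proof.
split; first by rewrite unfold_in /in_carrier inE; apply/carrierE; apply: famS (fam1 S) => x /eqP.
move=> f g; rewrite !unfold_in /in_carrier !inE => /carrierE Sf /carrierE Sg; apply/carrierE.
apply: famS (famU Sf Sg) => x; rewrite /supp /= => fgx.
have [fx|] := eqVneq (f x) 0; [right|by left].
apply: contra_neq fgx => gx; rewrite [LHS]/GRing.add /= fx add0r.
by rewrite [LHS]/GRing.opp /= gx oppr0.
Qed.

HB.instance Definition _ :=
  GRing.isZmodClosed.Build _ (in_carrier S)
    carrier_zmod_closed.

HB.instance Definition _ := [SubChoice_isSubZmodule of series S by <:].

Lemma coef_in (f : series S) : carrier S f.
Proof. by have := coefP f; rewrite unfold_in /in_carrier inE. Qed.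

Lemma mono0_in : mono 0 \in in_carrier S.
Proof.
rewrite unfold_in /in_carrier inE; apply/carrierE; apply: famS (fam1 S) => x.
by rewrite /supp /mono /=; have [->|_] := eqVneq x 0; rewrite ?mulr0n ?eqxx.
Qed.

Lemma conv_in (f g : series S) : conv f g \in in_carrier S.
Proof. by rewrite unfold_in /in_carrier inE; apply: conv_closed; exact: coef_in. Qed.

Definition series_one : series S := Series mono0_in.
Definition series_mul (f g : series S) : series S := Series (conv_in f g).

Lemma series_mulA : associative series_mul.
Proof. by move=> f g h; apply/val_inj; apply: convA; exact: coef_in. Qed.

Lemma series_mulC : commutative series_mul.
Proof. by move=> f g; apply/val_inj; exact: convC. Qed.

Lemma series_mul1 : left_id series_one series_mul.
Proof. by move=> f; apply/val_inj; exact: mono_conv. Qed.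

Lemma series_mulDl : left_distributive series_mul +%R.
Proof. by move=> f g h; apply/val_inj; apply: convDl; exact: coef_in. Qed.

HB.instance Definition _ := GRing.Zmodule_isComPzRing.Build (series S)
  series_mulA series_mulC series_mul1 series_mulDl.

Lemma coefD (f g : series S) x : (f + g) x = f x + g x.
Proof. by []. Qed.

Lemma coef1 : (1 : series S) = mono 0 :> (G -> A).
Proof. by []. Qed.

Lemma coefM (f g : series S) : f * g = conv f g :> (G -> A).
Proof. by []. Qed.

End Ring.
End Formal.

(* Supports which are finite in every half-space eta_i >= C. *)
Section Tame.
Variables (D : realDomainType) (k : nat) (eta : 'I_k -> 'rV[int]_k -> D).
Hypothesis etaD : forall i x y, eta i (x + y) = eta i x + eta i y.

Definition tame : set (set 'rV[int]_k) :=
  [set B | forall i C, finite_set [set g | B g /\ C <= eta i g]].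

Definition tame_minus : set (set 'rV[int]_k) :=
  [set B | tame B /\ forall i g, B g -> eta i g <= 0].

Let eta0 i : eta i 0 = 0.
Proof. by apply: (addrI (eta i 0)); rewrite -etaD !addr0. Qed.

Lemma tame1 : tame [set 0].
Proof. by move=> i C; apply: sub_finite_set (finite_set1 0) => g []. Qed.

Lemma tameS B C : B `<=` C -> tame C -> tame B.
Proof.
by move=> BC tC i c; apply: sub_finite_set (tC i c) => g [/BC].
Qed.

Lemma tameU B C : tame B -> tame C -> tame (B `|` C).
Proof.
move=> tB tC i c; have /= := conj (tB i c) (tC i c).
rewrite -finite_setU; apply: sub_finite_set => g [[Bg|Cg] cg]; by [left|right].
Qed.

Lemma tame_bound B i : tame B -> exists M, forall g, B g -> eta i g <= M.
Proof.
move=> tB; have [s _ sP] := finite_uniq_seq (tB i 0).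
exists (\sum_(g <- s) `|eta i g|) => g Bg.
have [eg|eg] := leP 0 (eta i g); last first.
  by apply: le_trans (ltW eg) _; apply: sumr_ge0 => *; exact: normr_ge0.
rewrite (big_rem g) /=; last by apply: sP.
apply: le_trans (ler_norm _) _; rewrite lerDl.
by apply: sumr_ge0 => *; exact: normr_ge0.
Qed.

Lemma tameD B C :
  tame B -> tame C -> tame [set x | exists y, B y /\ C (x - y)].
Proof.
move=> tB tC i c; have [M BM] := tame_bound i tB.
have [N CN] := tame_bound i tC.
have := finite_image2 (fun x y => x + y) (tB i (c - N)) (tC i (c - M)).
apply: sub_finite_set => x [[y [By Cy]]].
rewrite -{1}(subrK y x) etaD => cx.
exists y; first by split=> //; rewrite lerBlDr; apply: le_trans cx _;
  rewrite addrC lerD2l CN.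
exists (x - y); last by rewrite addrC subrK.
by split=> //; rewrite lerBlDr; apply: le_trans cx _; rewrite lerD2l BM.
Qed.

Lemma tameF B C x : tame B -> tame C -> finite_set [set y | B y /\ C (x - y)].
Proof.
move=> tB tC; case: (posnP k) => [k0|k_gt0].
  apply: sub_finite_set (finite_set1 (0 : 'rV[int]_k)) => y _ /=.
  by apply/rowP => j; have := ltn_ord j; rewrite {2}k0.
pose i := Ordinal k_gt0; have [M CM] := tame_bound i tC.
apply: sub_finite_set (tB i (eta i x - M)) => y /= [By Cy]; split=> //.
by rewrite lerBlDr -{1}(subrK y x) etaD addrC lerD2l CM.
Qed.

Lemma tame_minus1 : tame_minus [set 0].
Proof. by split; [exact: tame1|move=> i g ->; rewrite eta0]. Qed.

Lemma tame_minusS B C : B `<=` C -> tame_minus C -> tame_minus B.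
Proof.
move=> BC [tC nC]; split; first exact: tameS tC.
by move=> i g /BC; exact: nC.
Qed.

Lemma tame_minusU B C : tame_minus B -> tame_minus C -> tame_minus (B `|` C).
Proof.
move=> [tB nB] [tC nC]; split; first exact: tameU.
by move=> i g [/nB|/nC].
Qed.

Lemma tame_minusD B C : tame_minus B -> tame_minus C ->
  tame_minus [set x | exists y, B y /\ C (x - y)].
Proof.
move=> [tB nB] [tC nC]; split; first exact: tameD.
move=> i x [y [By Cy]]; rewrite -(subrK y x) etaD.
rewrite -[leRHS](addr0 0); apply: lerD; [exact: nC|exact: nB].
Qed.

Lemma tame_minusF B C x :
  tame_minus B -> tame_minus C -> finite_set [set y | B y /\ C (x - y)].
Proof. by move=> [tB _] [tC _]; exact: tameF. Qed.

Variable A : comPzRingType.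

Definition tame_convSet (S : set ('rV[int]_k -> A))
    (SE : forall f, S f <-> tame (supp f)) : convSet 'rV[int]_k A :=
  ConvSet SE tame1 tameS tameU tameD tameF.

Definition tame_minus_convSet (S : set ('rV[int]_k -> A))
    (SE : forall f, S f <-> tame_minus (supp f)) : convSet 'rV[int]_k A :=
  ConvSet SE tame_minus1 tame_minusS tame_minusU tame_minusD tame_minusF.

End Tame.

Section Completions.
Variables (R : realType) (k : nat).
Implicit Types (eta : 'rV[int]_k -> R).
Variable Gamma : 'I_k -> {additive 'rV[int]_k -> int}.

Definition hatLambda eta : set ('rV[int]_k -> int) :=
  [set l | forall C : R, finite_set [set g | supp l g /\ C <= eta g]].

Definition hatLambda_minus eta : set ('rV[int]_k -> int) :=
  [set l | hatLambda eta l /\ supp l `<=` eta @^-1` [set x | x <= 0]].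

Definition realhom (i : 'I_k) : 'rV[int]_k -> R := fun g => (Gamma i g)%:~R.

Lemma realhomD i x y : realhom i (x + y) = realhom i x + realhom i y.
Proof. by rewrite /realhom raddfD rmorphD. Qed.

Definition hatLambdaGamma_set : set ('rV[int]_k -> int) :=
  \bigcap_(i in [set: 'I_k]) hatLambda (realhom i).

Definition hatLambdaGamma_minus_set : set ('rV[int]_k -> int) :=
  \bigcap_(i in [set: 'I_k]) hatLambda_minus (realhom i).

Lemma hatLambdaGammaE l : hatLambdaGamma_set l <-> tame realhom (supp l).
Proof. by split=> [h i|h i _]; exact: h. Qed.

Lemma hatLambdaGamma_minusE l :
  hatLambdaGamma_minus_set l <-> tame_minus realhom (supp l).
Proof.
split=> [h|[h1 h2] i _]; last by split; [exact: h1|exact: h2].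
by split=> [i|i g sg]; [exact: (h i I).1|exact: (h i I).2].
Qed.

Definition hatLambdaGamma := series (tame_convSet realhomD hatLambdaGammaE).
HB.instance Definition _ := GRing.ComPzRing.on hatLambdaGamma.

Definition hatLambdaGamma_minus :=
  series (tame_minus_convSet realhomD hatLambdaGamma_minusE).
HB.instance Definition _ := GRing.ComPzRing.on hatLambdaGamma_minus.

End Completions.

Section SpecialSeries.
Variables (k : nat) (A : comPzRingType).

Definition strongly_to_infty (I : nat -> 'rV[int]_k) : Prop :=
  forall (j : 'I_k) (M : int), \forall n \near \oo, M <= I n 0 j.

(* The series \sum_n a_n t^(I_n) as the family of its coefficients: only
   finitely many n contribute to each J when I strongly converges to infinity
   and k > 0. *)
Definition series_of (a : nat -> A) (I : nat -> 'rV[int]_k) :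
    'rV[int]_k -> A :=
  fun J => \sum_(n \in [set n | I n = J]) a n.

Definition special_laurent_set : set ('rV[int]_k -> A) :=
  [set c | exists a I, strongly_to_infty I /\ c = series_of a I].

Definition special_power_set : set ('rV[int]_k -> A) :=
  [set c | exists a I, [/\ strongly_to_infty I,
     forall n j, 0 <= I n 0 j & c = series_of a I]].

Definition ncoord (j : 'I_k) (J : 'rV[int]_k) : int := - J 0 j.

Lemma ncoordD j x y : ncoord j (x + y) = ncoord j x + ncoord j y.
Proof. by rewrite /ncoord mxE opprD. Qed.

Lemma supp_series_of a I J : supp (series_of a I) J -> exists n, I n = J.
Proof.
move=> sJ; apply: contrapT => nex; move/negP: sJ; apply; apply/eqP.
by rewrite /series_of fsbig1// => n nJ; case: nex; exists n.
Qed.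

Lemma tame_series_of a I :
  strongly_to_infty I -> tame ncoord (supp (series_of a I)).
Proof.
move=> sI j C; have [N _ NP] := sI j (1 - C).
apply: sub_finite_set (finite_image I (finite_II N)) => J [/supp_series_of].
move=> [n nJ]; rewrite /ncoord lerNr => CJ; exists n => //=.
rewrite ltnNge; apply/negP => /NP /=; rewrite nJ => /le_trans/(_ CJ).
by rewrite gerDr ler10.
Qed.

(* Conversely enumerate the support by [pickle], filling the gaps with zero
   terms. *)
Lemma series_of_tame c : tame ncoord (supp c) ->
  exists a I, [/\ strongly_to_infty I,
    forall n, supp c (I n) \/ forall j, I n 0 j = n%:Z & c = series_of a I].
Proof.
move=> tc.
pose e n : option 'rV[int]_k :=
  if pickle_inv n is Some J then if c J != 0 then Some J else None else None.
have eK n J : e n = Some J -> pickle J = n /\ c J != 0.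
  rewrite /e; case E: (pickle_inv n) => [J'|] //; case: ifP => // cJ [<-].
  by split=> //; have := @pickle_invK 'rV[int]_k n; rewrite E.
have eP J : c J != 0 -> e (pickle J) = Some J.
  by move=> cJ; rewrite /e pickleK_inv cJ.
exists (fun n => if e n is Some J then c J else 0).
exists (fun n => if e n is Some J then J else \row_j n%:Z).
split.
- move=> j M; have [s _ sP] := finite_uniq_seq (tc j (- M)).
  exists (`|M|%N + \sum_(J <- s) (pickle J).+1)%N => // n /= Nn.
  case E: (e n) => [J|]; last first.
    rewrite mxE; apply: le_trans (ler_norm M) _.
    by rewrite -abszE lez_nat; apply: leq_trans Nn; exact: leq_addr.
  have [pJ cJ] := eK _ _ E; rewrite leNgt; apply/negP => JM.
  have Js : J \in s by apply: sP; split=> //; rewrite lerN2 ltW.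
  move: Nn; rewrite (big_rem J) //= -pJ leqNgt => /negP; apply.
  by rewrite addSn addnS ltnS addnCA leq_addr.
- move=> n; case E: (e n) => [J|]; first by left; case: (eK _ _ E).
  by right=> j; rewrite mxE.
- apply/funext => J; rewrite /series_of.
  have [cJ|cJ] := eqVneq (c J) 0.
    rewrite cJ fsbig1// => n /=; case E: (e n) => [J'|] // nJ.
    by rewrite nJ.
  rewrite (@fsbigE _ _ _ _ _ [:: pickle J]) //.
  + by rewrite big_cons big_nil mem_set/= eP// addr0.
  + by move=> n /=; rewrite inE => /eqP ->; rewrite eP.
  + move=> n /=; case E: (e n) => [J'|] // nJ; rewrite inE.
    by have [pJ _] := eK _ _ E; rewrite -pJ nJ eqxx.
Qed.

Lemma special_laurentE c : special_laurent_set c <-> tame ncoord (supp c).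
Proof.
split=> [[a [I [sI ->]]]|/series_of_tame[a [I [sI _ ->]]]].
  exact: tame_series_of.
by exists a, I.
Qed.

Lemma special_powerE c : special_power_set c <-> tame_minus ncoord (supp c).
Proof.
split=> [[a [I [sI pI ->]]]|[tc pc]].
  split; first exact: tame_series_of.
  by move=> j J /supp_series_of[n <-]; rewrite /ncoord oppr_le0.
have [a [I [sI nI E]]] := series_of_tame tc.
exists a, I; split=> // n j; case: (nI n) => [cI|-> //].
by have := pc j _ cI; rewrite /ncoord oppr_le0.
Qed.

Definition special_laurent := series (tame_convSet ncoordD special_laurentE).
HB.instance Definition _ := GRing.ComPzRing.on special_laurent.

Definition special_power :=
  series (tame_minus_convSet ncoordD special_powerE).
HB.instance Definition _ := GRing.ComPzRing.on special_power.

End SpecialSeries.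

Section Regular.
Variables (R : realType) (k : nat).

Definition Z_basis (V : zmodType) (b : 'I_k -> V) : Prop :=
  forall v, exists! n : {ffun 'I_k -> int}, v = \sum_i b i *~ n i.

Definition hom_basis (Gamma : 'I_k -> {additive 'rV[int]_k -> int}) : Prop :=
  forall eta : {additive 'rV[int]_k -> int},
    exists! n : {ffun 'I_k -> int}, forall g, eta g = \sum_i n i * Gamma i g.

Definition xi_regular (xi : {additive 'rV[int]_k -> R})
    (Gamma : 'I_k -> {additive 'rV[int]_k -> int}) : Prop :=
  hom_basis Gamma /\
  exists c : 'I_k -> R, (forall i, 0 < c i) /\
    forall g, xi g = \sum_i c i * (Gamma i g)%:~R.

Definition dual_basis (t : 'I_k -> 'rV[int]_k)
    (nu : 'I_k -> {additive 'rV[int]_k -> int}) : Prop :=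
  Z_basis t /\ forall i j, nu i (t j) = (i == j)%:R.

End Regular.

(* Main.v *)
Require Import Defs.
From HB Require Import structures.
From mathcomp Require Import all_boot all_order all_algebra.
From mathcomp Require Import boolp classical_sets functions cardinality fsbigop.
From mathcomp Require Import filter reals.

Set Implicit Arguments.
Unset Strict Implicit.
Unset Printing Implicit Defensive.

Import Order.TTheory GRing.Theory Num.Theory.
Local Open Scope ring_scope.

(* The isomorphism g |-> (- Gamma_j g)_j of Z^k onto its group of exponents,
   inverse to J |-> t^J, turns Gamma_i into J |-> - J_i.  Hence pulling back
   formal combinations along J |-> t^J identifies the two support conditions
   and commutes with convolution. *)

(** * Transport of series rings along a group isomorphism *)

Section Transport.
Variables (G H : zmodType) (A : comPzRingType).
Variables (phi : {additive H -> G}) (psi : G -> H).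
Hypotheses (phiK : cancel phi psi) (psiK : cancel psi phi).

(** Reindexing along the bijection [phi] is valid for arbitrary [f] and [g]: when infinitely many
    terms are nonzero, both sides take the default value 0. *)
Lemma conv_comp (f g : G -> A) :
  conv f g \o phi = conv (f \o phi) (g \o phi).
Proof.
apply/funext => x; rewrite /conv /= (@reindex_fsbigT _ _ _ _ _ phi).
  by apply: eq_fsbigr => y _; rewrite /= raddfB.
by exists psi.
Qed.

Lemma mono_comp (x : H) : mono A (phi x) \o phi = mono A x.
Proof. by apply/funext => y; rewrite /mono /= (can_eq phiK). Qed.

Variables (S : convSet G A) (T : convSet H A).
Hypothesis carrier_pull : forall f, carrier S f -> carrier T (f \o phi).
Hypothesis carrier_push : forall f, carrier T f -> carrier S (f \o psi).

Lemma pull_in (f : series S) : coef f \o phi \in in_carrier T.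
Proof. by rewrite unfold_in /in_carrier inE; exact/carrier_pull/coef_in. Qed.

Lemma push_in (f : series T) : coef f \o psi \in in_carrier S.
Proof. by rewrite unfold_in /in_carrier inE; exact/carrier_push/coef_in. Qed.

Definition pull (f : series S) : series T := Series (pull_in f).
Definition push (f : series T) : series S := Series (push_in f).

Lemma pull_zmod_morphism : zmod_morphism pull.
Proof. by move=> f g; exact/val_inj. Qed.

Lemma pull_monoid_morphism : monoid_morphism pull.
Proof.
split; last by move=> f g; apply/val_inj; exact: conv_comp.
(* The unit is the monomial at 0; reading this 0 as [phi 0] brings it under [mono_comp]. *)
by apply/val_inj; rewrite /= -[in LHS](raddf0 phi) mono_comp.
Qed.

HB.instance Definition _ :=
  GRing.isZmodMorphism.Build (series S) (series T) pull pull_zmod_morphism.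
HB.instance Definition _ :=
  GRing.isMonoidMorphism.Build (series S) (series T) pull pull_monoid_morphism.

Lemma pull_bij : bijective pull.
Proof.
exists push => f; apply/val_inj/funext => x /=; first by rewrite psiK.
by rewrite phiK.
Qed.

Lemma mono_in (x : G) : carrier T (mono A (psi x)) ->
  mono A x \in in_carrier S.
Proof.
move=> /carrier_push; rewrite unfold_in /in_carrier inE.
by congr (carrier S _); apply/funext => y; rewrite /mono /= (can_eq psiK).
Qed.

(** The clause on monomials pins the isomorphism down, so that variables can be matched later. It is
    restricted to monomials lying in [T], since a ring of power series excludes negative
    exponents. *)
Lemma series_iso : exists F : {rmorphism series S -> series T},
  bijective F /\ forall x, carrier T (mono A x) ->
    exists2 f : series S, coef f = mono A (phi x) & coef (F f) = mono A x.
Proof.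
exists pull; split; first exact: pull_bij.
move=> x Tx; have Sx : mono A (phi x) \in in_carrier S.
  by apply: mono_in; rewrite phiK.
by exists (Series Sx); last exact: mono_comp.
Qed.

End Transport.

(** * Finiteness conditions under change of coordinates *)

Section Tame.
Variables (k : nat).

(** Only an inclusion: [A] may be the zero ring, where the support is empty. *)
Lemma supp_mono (G : zmodType) (A : comPzRingType) (x : G) :
  (supp (mono A x) `<=` [set x])%classic.
Proof. by move=> y; rewrite /supp /mono /=; case: (y =P x); rewrite ?eqxx. Qed.

Lemma tame_mono (D : realDomainType) (eta : 'I_k -> 'rV[int]_k -> D)
    (A : comPzRingType) (x : 'rV[int]_k) : tame eta (supp (mono A x)).
Proof.
by move=> i C; apply: sub_finite_set (finite_set1 x) => g [/supp_mono].
Qed.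

(** The set to be bounded lies in the image under [v] of a finite set cut out of [B]. Two value
    domains occur because the heights are real on one side and integral on the other, so thresholds
    must be translated. *)
Lemma tame_preimage (D D' : realDomainType) (eta : 'I_k -> 'rV[int]_k -> D)
    (eta' : 'I_k -> 'rV[int]_k -> D') (u v : 'rV[int]_k -> 'rV[int]_k)
    (B : set 'rV[int]_k) :
  cancel u v ->
  (forall C, exists C', forall i x, C <= eta' i x -> C' <= eta i (u x)) ->
  tame eta B -> tame eta' (u @^-1` B)%classic.
Proof.
move=> uK le_eta tB i C; have [C' le_C'] := le_eta C.
apply: sub_finite_set (finite_image v (tB i C')) => x [Bx Cx].
by exists (u x); [split=> //; exact: le_C'|exact: uK].
Qed.

End Tame.

(** * Coordinates with respect to the dual basis *)

Section DualBasis.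
Variables (k : nat) (Gamma : 'I_k -> {additive 'rV[int]_k -> int}).
Variable t : 'I_k -> 'rV[int]_k.
Hypothesis t_dual : dual_basis t (fun i => \- Gamma i).

(** The product defining t^J appears as a sum, the group being written additively. *)
Definition monomial (J : 'rV[int]_k) : 'rV[int]_k := \sum_j t j *~ J 0 j.

(** By duality these are the coordinates of [g] along [t], given by a formula rather than chosen
    from the basis property. *)
Definition exponent (g : 'rV[int]_k) : 'rV[int]_k := \row_j - Gamma j g.

Lemma monomial_is_zmod_morphism : zmod_morphism monomial.
Proof.
move=> I J; rewrite /monomial -sumrB; apply: eq_bigr => j _.
by rewrite !mxE mulrzBr.
Qed.

HB.instance Definition _ :=
  GRing.isZmodMorphism.Build _ _ monomial monomial_is_zmod_morphism.

Lemma monomial_delta j : monomial (delta_mx 0 j) = t j.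
Proof.
rewrite /monomial (bigD1 j) //= mxE !eqxx big1 ?addr0 // => i ij.
by rewrite mxE (negPf ij) andbF mulr0z.
Qed.

Lemma Gamma_monomial i J : Gamma i (monomial J) = - J 0 i.
Proof.
have Gt j : Gamma i (t j) = - (i == j)%:R.
  by rewrite -(t_dual.2 i j) /= opprK.
rewrite raddf_sum (bigD1 i) //= big1 => [|j ji].
  by rewrite raddfMz Gt eqxx addr0 mulNrz intz.
by rewrite raddfMz Gt eq_sym (negPf ji) oppr0 mul0rz.
Qed.

Lemma monomialK : cancel monomial exponent.
Proof. by move=> J; apply/rowP => i; rewrite mxE Gamma_monomial opprK. Qed.

(** Since [t] spans, every [g] is a value of [monomial], and there the left inverse [exponent] is
    also a right inverse. *)
Lemma exponentK : cancel exponent monomial.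
Proof.
move=> g; have [n [-> _]] := t_dual.1 g.
have -> : \sum_i t i *~ n i = monomial (\row_i n i).
  by apply: eq_bigr => i _; rewrite mxE.
by rewrite monomialK.
Qed.

Lemma ncoord_exponent i g : ncoord i (exponent g) = Gamma i g.
Proof. by rewrite /ncoord mxE opprK. Qed.

Variable R : realType.

Lemma tame_monomial (B : set 'rV[int]_k) : tame (realhom R Gamma) B ->
  tame (@ncoord k) (monomial @^-1` B)%classic.
Proof.
apply: (tame_preimage monomialK) => C; exists C%:~R => i J.
by rewrite /realhom ler_int Gamma_monomial.
Qed.

Lemma tame_exponent (B : set 'rV[int]_k) : tame (@ncoord k) B ->
  tame (realhom R Gamma) (exponent @^-1` B)%classic.
Proof.
(* [Gamma i] takes integer values, so a real threshold can be rounded up without changing the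
   half-space. *)
apply: (tame_preimage exponentK) => C; exists (Num.ceil C) => i g.
by rewrite ncoord_exponent /realhom ceil_le_int.
Qed.

Lemma tame_minus_monomial (B : set 'rV[int]_k) :
  tame_minus (realhom R Gamma) B ->
  tame_minus (@ncoord k) (monomial @^-1` B)%classic.
Proof.
move=> [tB nB]; split; first exact: tame_monomial.
by move=> i J /(nB i); rewrite /realhom lerz0 Gamma_monomial.
Qed.

Lemma tame_minus_exponent (B : set 'rV[int]_k) : tame_minus (@ncoord k) B ->
  tame_minus (realhom R Gamma) (exponent @^-1` B)%classic.
Proof.
move=> [tB nB]; split; first exact: tame_exponent.
by move=> i g /(nB i); rewrite /realhom lerz0 ncoord_exponent.
Qed.

End DualBasis.

Theorem proposition4p3 (R : realType) (k : nat)
    (xi : {additive 'rV[int]_k -> R}) (xi_inj : injective xi)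
    (Gamma : 'I_k -> {additive 'rV[int]_k -> int})
    (Gamma_reg : xi_regular xi Gamma)
    (t : 'I_k -> 'rV[int]_k)
    (t_dual : dual_basis t (fun i => \- Gamma i)) :
  (exists f : {rmorphism hatLambdaGamma_minus R Gamma -> special_power k int},
      bijective f /\
      forall j, exists2 T : hatLambdaGamma_minus R Gamma,
        coef T = mono int (t j) & coef (f T) = mono int (delta_mx 0 j)) /\
  (exists f : {rmorphism hatLambdaGamma R Gamma -> special_laurent k int},
      bijective f /\
      forall j, exists2 T : hatLambdaGamma R Gamma,
        coef T = mono int (t j) & coef (f T) = mono int (delta_mx 0 j)).
Proof.
split.
- have [| |F [F_bij F_mono]] := @series_iso _ _ _ (monomial t)
    (exponent Gamma) (monomialK t_dual) (exponentK t_dual)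
    (tame_minus_convSet (realhomD R Gamma)
       (@hatLambdaGamma_minusE R k Gamma))
    (tame_minus_convSet (@ncoordD k) (@special_powerE k int)).
  (* The support of a composite is by conversion the preimage of the support, so membership reduces
     to the lemmas on preimages. *)
  + by move=> f /hatLambdaGamma_minusE /(tame_minus_monomial t_dual) ?;
      apply/special_powerE.
  + by move=> f /special_powerE /(tame_minus_exponent t_dual R) ?;
      apply/hatLambdaGamma_minusE.
  (* The basis element [t j] has the unit vector as its exponent; what remains is that this monomial
     is a special power series, its exponent being nonnegative. *)
  exists F; split=> // j; rewrite -(monomial_delta t); apply: F_mono.
  apply/special_powerE; split; first exact: tame_mono.
  by move=> i J /supp_mono ->; rewrite /ncoord mxE oppr_le0 ler0n.
- have [| |F [F_bij F_mono]] := @series_iso _ _ _ (monomial t)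
    (exponent Gamma) (monomialK t_dual) (exponentK t_dual)
    (tame_convSet (realhomD R Gamma)
       (@hatLambdaGammaE R k Gamma))
    (tame_convSet (@ncoordD k) (@special_laurentE k int)).
  + by move=> f /hatLambdaGammaE /(tame_monomial t_dual) ?;
      apply/special_laurentE.
  + by move=> f /special_laurentE /(tame_exponent t_dual) ?;
      apply/hatLambdaGammaE.
  exists F; split=> // j; rewrite -(monomial_delta t); apply: F_mono.
  by apply/special_laurentE; exact: tame_mono.
Qed.
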